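(* Assume that $0<\phi_{0*}\leq \phi_0(\mathbf{x})\leq \phi_0^*<1$ for constants $\phi_{0*},\phi_0^*$. Then the discrete porosity $\Psi$ computed by the fully discrete scheme is bounded: $$\phi_{0*}\leq \Psi_{i,j}^n<1,\qquad 1\leq i\leq N_x,\ 1\leq j\leq N_y,\ 0\le n\leq N.$$ It also holds that $$0\leq [d_t\Psi]_{i,j}^n< \frac{\alpha k_c a_0}{\rho_s\,(1-\phi_{0,i,j})},\qquad 1\leq i\leq N_x,\ 1\leq j\leq N_y,\ 1\le n\leq N.$$
   Context: Let $\Omega=(L_{lx},L_{rx})\times(L_{ly},L_{ry})$ be divided into $N_x\times N_y$ rectangular cells of a uniform mesh, with cell centers $(x_i,y_j)$, $1\le i\le N_x$, $1\le j\le N_y$; write $g_{i,j}=g(x_i,y_j)$. Let $Q>0$ be the final time, $\Delta t=Q/N$, $t^n=n\Delta t$, and $[d_tg]^n_{i,j}=(g^n_{i,j}-g^{n-1}_{i,j})/\Delta t$. The constants $\alpha,k_c,a_0,\rho_s$ are positive (dissolving power of the acid, local mass-transfer coefficient, initial interfacial area, density of the solid phase). The surface reaction rate $k_s(T)$ is a Lipschitz continuous function of temperature with $0<k_{s1}<k_s(T)<k_{s2}$ for constants $k_{s1},k_{s2}$. The function $\phi_0(\mathbf{x})$ is the initial porosity. Let $C^n_{f,i,j}$ and $Z^n_{i,j}$ denote the (real-valued) discrete acid concentration and discrete temperature at the cell centers at time $t^n$ (produced by the other equations of the scheme). The discrete porosity $\Psi$ is defined by $\Psi^0_{i,j}=\phi_{0,i,j}$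 and, for $n=0,\dots,N-1$, $$[d_t\Psi]^{n+1}_{i,j}=\frac{\alpha k_c a_0}{\rho_s}\left(1-\frac{1}{1+k_s(Z^n_{i,j})/k_c}\right)\frac{1-\Psi^{n+1}_{i,j}}{1-\Psi^0_{i,j}}\,\overline{C}^{\,n}_{f,i,j},\qquad \overline{C}^{\,n}_{f,i,j}=\max\{0,\min\{C^n_{f,i,j},1\}\}.$$ *)

(* Defs.v *)
From mathcomp Require Import all_boot all_order all_algebra.
From mathcomp Require Import all_classical all_reals all_analysis.
Set Implicit Arguments.
Unset Strict Implicit.
Unset Printing Implicit Defensive.
Import Order.TTheory GRing.Theory Num.Theory.
Import numFieldNormedType.Exports.
Local Open Scope classical_set_scope.
Local Open Scope ring_scope.

Definition rectangle (R : realType) (Llx Lrx Lly Lry : R) : set (R * R) :=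
  [set x | Llx < x.1 < Lrx /\ Lly < x.2 < Lry].

(* Cells are numbered from 0, so index (i, j) here is cell (i+1, j+1) in the
   1-based numbering, whose center has abscissa Llx + (i + 1/2) h. *)
Definition cell_center1 (R : realType) (L L' : R) (n : nat) (i : 'I_n) : R :=
  L + (i%:R + 2^-1) * ((L' - L) / n%:R).

Definition cell_center (R : realType) (Llx Lrx Lly Lry : R) (Nx Ny : nat)
    (i : 'I_Nx) (j : 'I_Ny) : R * R :=
  (cell_center1 Llx Lrx i, cell_center1 Lly Lry j).

(* g n i j is the value at the center of cell (i, j) at time t^n. *)
Definition grid_fun (R : realType) (Nx Ny : nat) := nat -> 'I_Nx -> 'I_Ny -> R.

(* Backward difference quotient, meaningful for n >= 1 only. *)
Definition d_t (R : realType) (Nx Ny : nat) (dt : R) (g : grid_fun R Nx Ny)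
    (n : nat) (i : 'I_Nx) (j : 'I_Ny) : R :=
  (g n i j - g n.-1 i j) / dt.

Definition clip01 (R : realType) (c : R) : R := Num.max 0 (Num.min c 1).

Definition porosity_scheme (R : realType) (Nx Ny N : nat)
    (dt alpha kc a0 rhos : R) (ks : R -> R) (phi0 : 'I_Nx -> 'I_Ny -> R)
    (C Z Psi : grid_fun R Nx Ny) : Prop :=
  (forall i j, Psi 0%N i j = phi0 i j) /\
  (forall n i j, (n < N)%N ->
     d_t dt Psi n.+1 i j =
       alpha * kc * a0 / rhos * (1 - 1 / (1 + ks (Z n i j) / kc))
       * ((1 - Psi n.+1 i j) / (1 - Psi 0%N i j)) * clip01 (C n i j)).

(* Main.v *)
Require Import Defs.
From mathcomp Require Import all_boot all_order all_algebra.
From mathcomp Require Import all_classical all_reals all_analysis.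
From mathcomp Require Import ring lra.
Import Order.TTheory GRing.Theory Num.Theory.
Import numFieldNormedType.Exports.
Local Open Scope classical_set_scope.
Local Open Scope ring_scope.

(** In each cell the scheme is one implicit Euler step for the scalar linear
    decay equation u' = - k u satisfied by u = 1 - Psi, with a rate k that
    depends on the step.  The temperature factor lies in ]0, 1[ and the clipped
    concentration in [0, 1], so that 0 <= k < K, where
    K = alpha kc a0 / (rhos (1 - phi0)).  Implicit Euler gives
    u^(n+1) = u^n / (1 + k dt) for every step size, whence
    0 < u^(n+1) <= u^n ([implicit_euler_decay]): the porosity increases and
    stays below 1, and by induction it stays above the lower bound of phi0.
    The difference quotient is then k u^(n+1), which is nonnegative, and, since
    Psi > 0 gives 0 < u^(n+1) < 1, it is at most k < K. *)

Lemma cell_center1_in (R : realType) (L L' : R) (n : nat) (i : 'I_n) :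
  L < L' -> L < cell_center1 L L' i < L'.
Proof.
move=> hL; rewrite /cell_center1.
have n0 : (0 : R) < n%:R by rewrite ltr0n (leq_ltn_trans _ (ltn_ord i)).
have i0 : (0 : R) <= i%:R by [].
have i1 : i%:R + 1 <= n%:R :> R by rewrite natr1 ler_nat.
have LL : 0 < L' - L by rewrite subr_gt0.
apply/andP; split.
  by rewrite ltrDl mulr_gt0 ?divr_gt0 //; lra.
rewrite addrC -ltrBrDr mulrCA gtr_pMr // ltr_pdivrMr // mul1r; lra.
Qed.

Lemma clip01_itv {R : realType} (c : R) : 0 <= clip01 c <= 1.
Proof. by rewrite /clip01 le_max lexx /= ge_max ler01 ge_min lexx orbT. Qed.

(** The factor is x / (1 + x) with x = k / kc > 0. *)
Lemma reaction_factor_itv {R : realType} {k kc : R} :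
  0 < k -> 0 < kc -> 0 < 1 - 1 / (1 + k / kc) < 1.
Proof.
move=> k0 kc0; have x0 : 0 < k / kc by rewrite divr_gt0.
have y0 : 0 < 1 + k / kc by lra.
by rewrite subr_gt0 gtrBl divr_gt0 // ltr_pdivrMr // mul1r ltrDl x0.
Qed.

(** The equation reads (1 - y) (1 + k dt) = 1 - x, with 1 + k dt >= 1
    whatever the step size; the implicit treatment of y is what makes this
    unconditional. *)
Lemma implicit_euler_decay {R : realType} {dt k x y : R} :
  0 < dt -> 0 <= k -> x < 1 -> (y - x) / dt = k * (1 - y) -> x <= y < 1.
Proof.
move=> dt0 k0 x1 /(congr1 ( *%R^~ dt)); rewrite divfK ?gt_eqF // => E.
have kdt0 : 0 <= k * dt by rewrite mulr_ge0 // ltW.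
have F : (1 - y) * (1 + k * dt) = 1 - x.
  by rewrite (_ : 1 - x = 1 - y + (y - x)); [rewrite E|]; ring.
have kdt1 : 0 < 1 + k * dt by lra.
have y1 : 0 < 1 - y by rewrite -(pmulr_lgt0 _ kdt1) F subr_gt0.
have := mulr_ge0 (mulr_ge0 k0 (ltW y1)) (ltW dt0).
by rewrite -E => ?; apply/andP; split; lra.
Qed.

(** The rate of a step: the last conjunct is strict although the concentration
    factor may equal 1, because the temperature factor is below 1. *)
Lemma porosity_rate {R : realType} {K g c w : R} (y : R) :
  0 < K -> 0 < g < 1 -> 0 <= c <= 1 -> 0 < w ->
  exists k : R, [/\ K * g * ((1 - y) / w) * c = k * (1 - y),
                    0 <= k & k < K / w].
Proof.
move=> K0 /andP[g0 g1] /andP[c0 c1] w0; exists (K / w * (g * c)).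
have Kw : 0 < K / w by rewrite divr_gt0.
split.
- by field; rewrite gt_eqF.
- by rewrite !mulr_ge0 ?invr_ge0 // ltW.
- by rewrite gtr_pMr // (le_lt_trans _ g1) // ler_piMr // ltW.
Qed.

Theorem lemma4p2 (R : realType)
  (Llx Lrx Lly Lry : R) (hLx : Llx < Lrx) (hLy : Lly < Lry)
  (Nx Ny N : nat) (hNx : (0 < Nx)%N) (hNy : (0 < Ny)%N) (hN : (0 < N)%N)
  (Q : R) (hQ : 0 < Q)
  (alpha kc a0 rhos : R)
  (halpha : 0 < alpha) (hkc : 0 < kc) (ha0 : 0 < a0) (hrhos : 0 < rhos)
  (ks : R -> R) (ks1 ks2 : R) (hks_lip : exists L : R, L.-lipschitz ks)
  (hks1 : 0 < ks1) (hks : forall T : R, ks1 < ks T /\ ks T < ks2)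
  (phi0 : R * R -> R) (phi_lo phi_hi : R)
  (hlo : 0 < phi_lo) (hhi : phi_hi < 1)
  (hphi0 : forall x : R * R, rectangle Llx Lrx Lly Lry x ->
     phi_lo <= phi0 x /\ phi0 x <= phi_hi)
  (C Z Psi : grid_fun R Nx Ny)
  (hPsi : porosity_scheme N (Q / N%:R) alpha kc a0 rhos ks
     (fun i j => phi0 (cell_center Llx Lrx Lly Lry i j)) C Z Psi) :
  (forall (n : nat) (i : 'I_Nx) (j : 'I_Ny), (n <= N)%N ->
     phi_lo <= Psi n i j /\ Psi n i j < 1) /\
  (forall (n : nat) (i : 'I_Nx) (j : 'I_Ny), (1 <= n)%N -> (n <= N)%N ->
     0 <= d_t (Q / N%:R) Psi n i j /\
     d_t (Q / N%:R) Psi n i j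
       < alpha * kc * a0 /
         (rhos * (1 - phi0 (cell_center Llx Lrx Lly Lry i j)))).
Proof.
case: hPsi => Psi0 step; set dt := Q / N%:R.
have dt0 : 0 < dt by rewrite divr_gt0 // ltr0n.
pose p0 (i : 'I_Nx) (j : 'I_Ny) := phi0 (cell_center Llx Lrx Lly Lry i j).
have p0_itv i j : phi_lo <= p0 i j < 1.
  have [|lo hi] := hphi0 (cell_center Llx Lrx Lly Lry i j).
    by split; apply: cell_center1_in.
  by rewrite lo (le_lt_trans hi).
have decay n i j : (n < N)%N -> exists k : R,
    [/\ d_t dt Psi n.+1 i j = k * (1 - Psi n.+1 i j), 0 <= k &
        k < alpha * kc * a0 / (rhos * (1 - p0 i j))].
  move=> nN; have [ks1T _] := hks (Z n i j).
  have w0 : 0 < 1 - p0 i j by have /andP[_] := p0_itv i j; rewrite subr_gt0.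
  have K0 : 0 < alpha * kc * a0 / rhos by rewrite divr_gt0 ?mulr_gt0.
  have [k [E k0 kK]] := porosity_rate (Psi n.+1 i j) K0
    (reaction_factor_itv (lt_trans hks1 ks1T) hkc) (clip01_itv (C n i j)) w0.
  exists k; split=> //; first by rewrite -E step // Psi0.
  by rewrite invfM mulrA.
have bounds n i j : (n <= N)%N -> phi_lo <= Psi n i j < 1.
  elim: n => [_|n IHn nN]; first by rewrite Psi0; apply: p0_itv.
  have /andP[lo hi] := IHn (ltnW nN).
  have [k [E k0 _]] := decay n i j nN.
  have /andP[mono ->] := implicit_euler_decay dt0 k0 hi E.
  by rewrite (le_trans lo mono).
split=> [n i j nN|[//|n] i j _ nN]; first exact/andP/bounds.
have [k [-> k0 kK]] := decay n i j nN.
have /andP[lo hi] := bounds _ i j nN.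
split; first by rewrite mulr_ge0 // subr_ge0 ltW.
by apply: le_lt_trans kK; rewrite ler_piMr // gerBl (le_trans (ltW hlo)).
Qed.
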